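(* Let $X$ be a metrizable uniform space. Then $X$ is a uniform ANR if and only if $X$ is uniformly locally contractible and satisfies the Hahn property.
   Context: A uniform ANR is a metrizable uniform space $Y$ such that for every uniform embedding $i$ of $Y$ onto a closed subspace of a metrizable uniform space $Z$ there exists a uniformly continuous retraction onto $i(Y)$ of some uniform neighborhood of $i(Y)$ in $Z$ (a set containing an $\varepsilon$-neighborhood of $i(Y)$ for some $\varepsilon>0$). Fix a metric inducing the uniformity of $X$ (the following two properties do not depend on its choice). ''$\delta$-close'' means at distance at most $\delta$ (for maps: pointwise, uniformly over the domain). $X$ is uniformly locally contractible if for each $\varepsilon>0$ there exists a $\delta>0$ such that for every (not necessarily metrizable) uniform space $Y$, every two $\delta$-close uniformly continuous maps $f,g\colon Y\to X$ are uniformly $\varepsilon$-homotopic, i.e. joined by a uniformly continuous homotopy $Y\times[0,1]\to X$ that is $\varepsilon$-close to the composition $Y\times[0,1]\xrightarrow{\text{projection}}Y\xrightarrow{f}X$. $X$ satisfies the Hahn property if for each $\varepsilon>0$ there exists a $\delta>0$ such that for every uniform space $Y$ and every $\delta$-continuous map $\Xi\colon Y\to X$ there exists a uniformly continuous map $f\colon Y\to X$ that is $\varepsilon$-close to $\Xi$. Here a possibly discontinuous map $\Xi$ is $\delta$-continuous if there exists a uniform cover $C$ of $Y$ such that $\Xi$ sends every element of $C$ into a set of diameter at most $\delta$. *)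

(* Defs.v *)
From HB Require Import structures.
From mathcomp Require Import all_boot all_order all_algebra.
From mathcomp Require Import all_classical all_reals all_analysis.
Set Implicit Arguments.
Unset Strict Implicit.
Unset Printing Implicit Defensive.
Import Order.TTheory GRing.Theory Num.Theory.
Import numFieldNormedType.Exports.
Local Open Scope classical_set_scope.
Local Open Scope ring_scope.

(* A metrizable uniform space is represented by a [metricType R]: the metric
   is one inducing the uniformity.  Arbitrary uniform spaces are
   [uniformType]s, which need not be separated.  Subsets are given their
   induced uniformity through [set_type]. *)

(* Injective, uniformly continuous, with uniformly continuous inverse
   [g : i(Y) -> Y]. *)
Definition uniform_embedding (Y Z : uniformType) (i : Y -> Z) : Prop :=
  [/\ injective i, unif_continuous i &
    exists2 g : set_type (range i) -> Y,
      unif_continuous g & forall u, i (g u) = set_val u].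

Definition uniform_neighborhood (R : realType) (Z : metricType R)
    (A U : set Z) : Prop :=
  exists2 e : R, 0 < e & forall a z, A a -> mdist a z < e -> U z.

Definition uniform_retraction (Z : uniformType) (U A : set Z)
    (r : set_type U -> Z) : Prop :=
  [/\ unif_continuous r, forall u, A (r u) &
    forall u, A (set_val u) -> r u = set_val u].

(* Only the uniformity of [Y], not its metric, is used. *)
Definition uniform_ANR (R : realType) (Y : metricType R) : Prop :=
  forall (Z : metricType R) (i : Y -> Z),
    uniform_embedding i -> closed (range i) ->
    exists2 U : set Z, uniform_neighborhood (range i) U &
      exists r : set_type U -> Z, uniform_retraction (range i) r.

Definition close_maps (R : realType) (S : Type) (X : metricType R) (d : R)
    (f g : S -> X) : Prop :=
  forall s, mdist (f s) (g s) <= d.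

Definition uniformly_homotopic (R : realType) (Y : uniformType)
    (X : metricType R) (e : R) (f g : Y -> X) : Prop :=
  exists H : Y * set_type (`[0, 1] : set R) -> X,
    [/\ unif_continuous H,
        forall y t, set_val t = 0 -> H (y, t) = f y,
        forall y t, set_val t = 1 -> H (y, t) = g y &
        close_maps e H (f \o fst)].

Definition uniformly_locally_contractible (R : realType) (X : metricType R)
    : Prop :=
  forall e : R, 0 < e -> exists2 d : R, 0 < d &
    forall (Y : uniformType) (f g : Y -> X),
      unif_continuous f -> unif_continuous g -> close_maps d f g ->
      uniformly_homotopic e f g.

(* The covering description of a uniformity: a family of sets is a uniform
   cover when it is refined by the cover by the [E]-neighborhoods of points,
   for some entourage [E]. *)
Definition uniform_cover (Y : uniformType) (C : set (set Y)) : Prop :=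
  exists2 E : set (Y * Y), entourage E &
    forall y, exists2 U, C U & [set z | E (y, z)] `<=` U.

Definition delta_continuous (R : realType) (Y : uniformType)
    (X : metricType R) (d : R) (xi : Y -> X) : Prop :=
  exists2 C : set (set Y), uniform_cover C &
    forall U, C U -> forall y z, U y -> U z -> mdist (xi y) (xi z) <= d.

Definition Hahn_property (R : realType) (X : metricType R) : Prop :=
  forall e : R, 0 < e -> exists2 d : R, 0 < d &
    forall (Y : uniformType) (xi : Y -> X), delta_continuous d xi ->
      exists2 f : Y -> X, unif_continuous f & close_maps e f xi.

(* Main.v *)
Require Import Defs.
From HB Require Import structures.
From mathcomp Require Import all_boot all_order all_algebra.
From mathcomp Require Import all_classical all_reals all_analysis.
From mathcomp Require Import lra.

(** Both implications rest on one passage between uniformly continuous maps and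
    maps that are only continuous up to a small error.

    Let [X] be uniformly locally contractible with the Hahn property, and let
    [i : X -> Z] be a closed uniform embedding.  Write [u] for the distance to
    the image and let [Xi : Z -> X] send a point to a nearly nearest point of
    the image; [Xi] is discontinuous, but its oscillation tends to 0 with [u].
    So the Hahn property gives, for every [e], a uniformly continuous map that
    is [e]-close to [Xi] where [u] is small.  Starting from such a map, one
    replaces it, ever closer to the image, by ever better approximations of
    [Xi], joining each one to the next along a small homotopy whose time
    parameter is a function of [u] ([improve_near_zero]).  The [n]-th change is
    at most [2^-n], so the maps converge uniformly; the limit is uniformly
    continuous and is the identity on the image.  The limit exists although [X]
    may be incomplete: the sequence is eventually constant off the image, and on
    the image its limit is known in advance ([retraction_near_zero]).

    Conversely, let [X] be a uniform ANR.  One embeds [X] by the truncated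
    Kuratowski map into the bounded functions on [X]; convex combinations and
    Lipschitz regularizations exist there, but the image is closed only if [X]
    is complete.  This is repaired by a height coordinate: the collar consists
    of all [[0, 1]]-valued functions at positive height together with the image
    of [X] at height 0, and there [X] is closed.  A uniformly continuous
    retraction of a neighbourhood pushes any uniformly continuous map into the
    collar that is close to [xi : Y -> X] to a uniformly continuous map into [X]
    close to [xi] ([push_into_base]).  For local contractibility one pushes the
    straight-line homotopy, lifted off the base at intermediate times.  For the
    Hahn property one pushes, at a constant small height, a regularization by
    suprema over a pseudometric subordinate to the given cover
    ([equicontinuous_approximation]). *)

Set Implicit Arguments.
Unset Strict Implicit.
Unset Printing Implicit Defensive.
Import Order.TTheory GRing.Theory Num.Theory.
Import numFieldNormedType.Exports.
Local Open Scope classical_set_scope.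
Local Open Scope ring_scope.

(** * Uniform continuity in terms of distances *)

Lemma entourage_mdistP (R : realType) (M : metricType R) (E : set (M * M)) :
  entourage E <->
  exists2 d : R, 0 < d & forall x y, mdist x y < d -> E (x, y).
Proof.
rewrite -entourage_from_ballE; split=> -[d d0 dE]; exists d => //.
- by move=> x y xy; apply: dE; rewrite /= ballEmdist.
- by move=> [x y]; rewrite /= ballEmdist; exact: dE.
Qed.

Lemma unif_continuous_mdistP (R : realType) (Y : uniformType) (M : metricType R)
    (f : Y -> M) :
  unif_continuous f <->
  forall e : R, 0 < e -> entourage [set p : Y * Y | mdist (f p.1) (f p.2) < e].
Proof.
split=> [uf e e0|uf E /entourage_mdistP[e e0 eE]].
  apply: (uf [set q : M * M | mdist q.1 q.2 < e]).
  by apply/entourage_mdistP; exists e.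
apply: filterS (uf e e0) => p /=; exact: eE.
Qed.

(** Uniform continuity of the restriction to [A], kept on total functions so
    that maps on varying neighbourhoods can be compared. *)
Definition unif_continuous_on (R : realType) (Z X : metricType R) (A : set Z)
    (f : Z -> X) : Prop :=
  forall e : R, 0 < e -> exists2 d : R, 0 < d &
    forall z z', A z -> A z' -> mdist z z' < d -> mdist (f z) (f z') < e.

Lemma entourage_set_typeP (R : realType) (Z : metricType R) (A : set Z)
    (E : set (set_type A * set_type A)) :
  entourage E <-> exists2 d : R, 0 < d &
    forall a b, mdist (set_val a) (set_val b) < d -> E (a, b).
Proof.
split=> [[V /entourage_mdistP[d d0 dV] VE]|[d d0 dE]].
  by exists d => // a b ab; apply: VE; exact: dV.
exists [set p : Z * Z | mdist p.1 p.2 < d].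
  by apply/entourage_mdistP; exists d.
by move=> [a b]; exact: dE.
Qed.

Lemma entourage_prodP (U V : uniformType) (E : set ((U * V) * (U * V))) :
  entourage E <-> exists A B, [/\ entourage A, entourage B &
    forall u v u' v', A (u, u') -> B (v, v') -> E ((u, v), (u', v'))].
Proof.
split=> [[[A B] /= [eA eB] AB]|[A [B [eA eB AB]]]].
  exists A, B; split=> // u v u' v' Auu Bvv.
  have /AB : (A `*` B) ((u, u'), (v, v')) by [].
  by move=> [[[a b] [c d]] /= Ep [<- <- <- <-]].
exists (A, B) => //= -[[u u'] [v v']] /= [Auu Bvv].
by exists ((u, v), (u', v')) => //; exact: AB.
Qed.

Lemma unif_continuous_on_set_val (R : realType) (Z X : metricType R)
    (A : set Z) (f : Z -> X) :
  unif_continuous_on A f -> unif_continuous (f \o set_val : set_type A -> X).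
Proof.
move=> uf; apply/unif_continuous_mdistP => e /uf[d d0 fd].
apply/entourage_set_typeP; exists d => // a b; apply: fd; exact: set_valP.
Qed.

(** * From local contractibility and the Hahn property to retractions *)

Lemma unit_clamp_subproof (R : realType) (s : R) :
  Num.min 1 (Num.max 0 s) \in [set` (`[0, 1] : interval R)].
Proof.
by apply/mem_set; rewrite /= in_itv /= le_min le_max ge_min !lexx ler01.
Qed.

Definition unit_clamp (R : realType) (s : R) : set_type (`[0, 1] : set R) :=
  SigSub (unit_clamp_subproof s).

Lemma set_val_unit_clamp (R : realType) (s : R) :
  set_val (unit_clamp s) = Num.min 1 (Num.max 0 s).
Proof. by []. Qed.

Lemma unit_clamp_lipschitz (R : realType) (s s' : R) :
  `|set_val (unit_clamp s) - set_val (unit_clamp s')| <= `|s - s'|.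
Proof.
rewrite !set_val_unit_clamp.
have := ler_norm (s - s'); have := ler_norm (s' - s).
rewrite (distrC s') ler_norml.
case: (lerP 0 s) => ?; case: (lerP 0 s') => ?;
  try case: (lerP 1 s) => ?; try case: (lerP 1 s') => ?;
  try case: (lerP 1 0) => ?; move=> ? ?; apply/andP; split; lra.
Qed.

Section Retraction.
Variables (R : realType) (X Z : metricType R) (u : Z -> R).
Hypothesis u_lip : forall z z', `|u z - u z'| <= mdist z z'.

(** Running the homotopy at the time [(b - u z) / (b - a)], clamped to [[0, 1]],
    turns it into a single map that switches from [f] to [g] as [u] decreases
    from [b] to [a]. *)
Lemma homotopy_blend (A : set Z) (f g : Z -> X) (e a b : R) :
  a < b ->
  uniformly_homotopic e (f \o set_val : set_type A -> X) (g \o set_val) ->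
  exists h : Z -> X, [/\ unif_continuous_on A h,
    forall z, A z -> b <= u z -> h z = f z,
    forall z, A z -> u z <= a -> h z = g z &
    forall z, A z -> mdist (h z) (f z) <= e].
Proof.
move=> ab [H [/unif_continuous_mdistP uH H0 H1 He]].
pose t z := unit_clamp ((b - u z) / (b - a)).
have ba0 : 0 < b - a by rewrite subr_gt0.
pose h z := match pselect (A z) with
  | left Az => H (SigSub (mem_set Az), t z) | right _ => f z end.
have hE z (Az : A z) : h z = H (SigSub (mem_set Az), t z).
  rewrite /h; case: pselect => // Az'.
  by congr (H (_, _)); apply: val_inj.
exists h; split.
- move=> e' /uH/entourage_prodP[P [Q [/entourage_set_typeP[d d0 dP] eQ PQ]]].
  move: eQ => /= [W /= eW WQ].
  have := eW; rewrite -(@entourage_from_ballE R R) => -[d' d'0 d'W].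
  exists (Num.min d (d' * (b - a))); first by rewrite lt_min d0 mulr_gt0.
  move=> z z' Az Az'; rewrite lt_min => /andP[zd zd'].
  rewrite (hE _ Az) (hE _ Az'); apply: PQ; first exact: dP.
  apply: WQ; apply: d'W; rewrite /ball /=.
  apply: le_lt_trans (unit_clamp_lipschitz _ _) _.
  rewrite -mulrBl normrM [X in _ * X]gtr0_norm ?invr_gt0// ltr_pdivrMr//.
  apply: le_lt_trans zd'; rewrite opprB addrC addrA subrK distrC; exact: u_lip.
- move=> z Az bu; rewrite (hE _ Az) H0//.
  rewrite set_val_unit_clamp max_l ?min_r//.
  by rewrite pmulr_lle0 ?invr_gt0// subr_le0.
- move=> z Az ua; rewrite (hE _ Az) H1// set_val_unit_clamp.
  have t1 : 1 <= (b - u z) / (b - a).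
    by rewrite ler_pdivlMr// mul1r lerD2l lerN2.
  by rewrite max_r ?min_l// (le_trans _ t1).
- by move=> z Az; rewrite (hE _ Az); exact: He.
Qed.

(** The two pieces agree on the whole band [a <= u <= b].  Since [u] is
    1-Lipschitz, two points at distance less than [b - a] cannot lie on opposite
    sides of the band, so one of the two moduli of continuity always applies;
    agreement on [u = a] alone would not suffice. *)
Lemma unif_continuous_on_glue (A : set Z) (f h : Z -> X) (a b : R) :
  a < b -> unif_continuous_on A f ->
  unif_continuous_on (A `&` [set z | u z <= b]) h ->
  (forall z, A z -> a <= u z <= b -> h z = f z) ->
  unif_continuous_on A (fun z => if u z < a then h z else f z).
Proof.
move=> ab uf uh hf e e0.
have [d1 d10 fd] := uf e e0; have [d2 d20 hd] := uh e e0.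
exists (Num.min (Num.min d1 d2) (b - a)).
  by rewrite !lt_min d10 d20 subr_gt0.
have near_b z z' : mdist z z' < b - a -> u z < a -> u z' <= b.
  move=> zz' uz; have := u_lip z z'; rewrite ler_norml => /andP[+ _]; lra.
have sub z : u z < a -> u z <= b by move=> uz; rewrite ltW// (lt_trans uz).
move=> z z' Az Az'; rewrite !lt_min => /andP[/andP[zd1 zd2] zab].
case: (ltP (u z) a) => uz; case: (ltP (u z') a) => uz'.
- by apply: hd => //; split=> //; exact: sub.
- have u'b := near_b _ _ zab uz.
  by rewrite -hf ?uz'//; apply: hd => //; split=> //; exact: sub.
- have ub : u z <= b by apply: near_b uz'; rewrite metric_sym.
  by rewrite -hf ?uz//; apply: hd => //; split=> //; exact: sub.
- exact: fd.
Qed.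

(** Uniform local contractibility with the choice of [d] made once and for all;
    [delta e <= e] is added so that closeness to [Xi] improves along with the
    homotopies. *)
Definition homotopy_modulus (delta : R -> R) : Prop :=
  forall e, 0 < e -> [/\ 0 < delta e, delta e <= e &
    forall (Y : uniformType) (f g : Y -> X),
      unif_continuous f -> unif_continuous g -> close_maps (delta e) f g ->
      uniformly_homotopic e f g].

Definition approximable_near_zero (Xi : Z -> X) : Prop :=
  forall e, 0 < e -> exists2 c, 0 < c & exists2 f : Z -> X,
    unif_continuous_on [set z | u z <= c] f &
    forall z, u z <= c -> mdist (f z) (Xi z) <= e.

Variables (delta : R -> R) (Xi : Z -> X).
Hypothesis deltaP : homotopy_modulus delta.
Hypothesis XiP : approximable_near_zero Xi.

Lemma unif_continuous_on_sub (A B : set Z) (f : Z -> X) :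
  A `<=` B -> unif_continuous_on B f -> unif_continuous_on A f.
Proof.
move=> AB uf e /uf[d d0 fd]; exists d => // z z' Az Az'.
by apply: fd; exact: AB.
Qed.

(** The half leaves room for the triangle inequality: two maps that are this
    close to [Xi] are [delta e]-close to each other, hence [e]-homotopic. *)
Definition good_near_zero (A : set Z) (e : R) (f : Z -> X) : Prop :=
  unif_continuous_on A f /\ exists2 c, 0 < c &
    forall z, A z -> u z <= c -> mdist (f z) (Xi z) <= delta e / 2.

(** The inductive step.  On a thin set [u <= b] both [f] and a better
    approximation [g] of [Xi] are available and are joined by an [e]-homotopy.
    The new map is [f] down to [u = b / 2] and has become [g] at [u = b / 3]. *)
Lemma improve_near_zero (A : set Z) (e e' : R) (f : Z -> X) :
  0 < e -> 0 < e' -> good_near_zero A e f ->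
  exists f' : Z -> X, [/\ good_near_zero A e' f',
    forall z, A z -> mdist (f' z) (f z) <= e &
    forall z, e <= u z -> f' z = f z].
Proof.
move=> e0 e'0 [uf [c c0 fc]].
have [de0 _ dh] := deltaP e0; have [de'0 _ _] := deltaP e'0.
pose e1 := Num.min (delta e) (delta e') / 2.
have e10 : 0 < e1 by rewrite divr_gt0// lt_min de0.
have [c1 c10 [g ug gXi]] := XiP e10.
pose b := Num.min (Num.min c c1) e.
have b0 : 0 < b by rewrite !lt_min c0 c10.
have [bc bc1 be] : [/\ b <= c, b <= c1 & b <= e].
  by rewrite /b; split; rewrite !ge_min lexx ?orbT.
pose B := A `&` [set z | u z <= b].
have BA : B `<=` A by move=> z [].
have ufB : unif_continuous_on B f by exact: unif_continuous_on_sub uf.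
have ugB : unif_continuous_on B g.
  by apply: unif_continuous_on_sub ug => z [_ /= /le_trans]; exact.
have e1e : e1 <= delta e / 2 by rewrite ler_pM2r ?invr_gt0// ge_min lexx.
have e1e' : e1 <= delta e' / 2.
  by rewrite ler_pM2r ?invr_gt0// ge_min lexx orbT.
have fg : close_maps (delta e) (f \o set_val : set_type B -> X) (g \o set_val).
  move=> s; have [As us] := set_valP s.
  apply: le_trans (metric_triangle _ (Xi (set_val s)) _) _.
  have := fc _ As (le_trans us bc); have := gXi _ (le_trans us bc1).
  by rewrite (metric_sym (Xi _)) /comp; lra.
have ab : b / 3 < b / 2 by lra.
have [h [uh hf hg hfe]] := homotopy_blend ab (dh _ _ _
  (unif_continuous_on_set_val ufB) (unif_continuous_on_set_val ugB) fg).
have b2b : b / 2 < b by lra.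
exists (fun z => if u z < b / 2 then h z else f z); split.
- split.
    apply: (unif_continuous_on_glue b2b uf uh) => z Az /andP[bz zb].
    exact: hf.
  exists (b / 3); first by lra.
  move=> z Az uz; have uz2 : u z < b / 2 by exact: le_lt_trans ab.
  rewrite uz2 hg//; last by split=> //=; lra.
  by apply: le_trans e1e'; apply: gXi; lra.
- move=> z Az; case: ltP => uz; last by rewrite mdistxx ltW.
  by apply: hfe; split=> //=; lra.
- by move=> z ez; case: ltP => // uz; exfalso; lra.
Qed.

Lemma unif_continuous_on_limit (A : set Z) (f : nat -> Z -> X) (r : Z -> X) :
  (forall n, unif_continuous_on A (f n)) ->
  (forall e, 0 < e -> exists n, forall z, A z -> mdist (f n z) (r z) <= e) ->
  unif_continuous_on A r.
Proof.
move=> uf fr e e0; have e3 : 0 < e / 4 by lra.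
have [n nr] := fr _ e3; have [d d0 fd] := uf n _ e3.
exists d => // z z' Az Az' zz'; have := fd _ _ Az Az' zz'.
have := nr _ Az; have := nr _ Az'; rewrite (metric_sym (f n z)).
have := metric_triangle (r z) (f n z) (r z').
have := metric_triangle (f n z) (f n z') (r z').
lra.
Qed.

Hypothesis u_ge0 : forall z, 0 <= u z.

(** Iterating the step with [e = 2^-n] gives a uniformly Cauchy sequence.  Its
    limit exists in any [X]: where [0 < u] the sequence is eventually constant,
    since the [n]-th step changes nothing on [2^-n <= u], and where [u = 0] it
    converges to [Xi]. *)
Lemma retraction_near_zero : exists2 c, 0 < c & exists2 r : Z -> X,
  unif_continuous_on [set z | u z <= c] r &
  forall z, u z = 0 -> r z = Xi z.
Proof.
pose q n : R := 2^-1 ^+ n.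
have q0 n : 0 < q n by rewrite exprn_gt0.
have qS n : q n.+1 = q n / 2 by rewrite /q exprSr.
have q_small e : 0 < e -> exists n, q n <= e.
  move=> e0; have [N _ NP] := near_infty_natSinv_expn_lt (PosNum e0).
  exists N; have := NP N (leqnn N).
  by rewrite /q exprVn div1r => /ltW.
have dq0 : 0 < delta (q 0%N) / 2 by have [? _ _] := deltaP (q0 0%N); lra.
have [c c0 [f0 uf0 f0Xi]] := XiP dq0.
exists c => //; pose A := [set z | u z <= c].
have step (p : nat * (Z -> X)) : exists f' : Z -> X,
    good_near_zero A (q p.1) p.2 -> [/\ good_near_zero A (q p.1.+1) f',
    forall z, A z -> mdist (f' z) (p.2 z) <= q p.1 &
    forall z, q p.1 <= u z -> f' z = p.2 z].
  have [good|] := pselect (good_near_zero A (q p.1) p.2); last by exists f0.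
  by have [f' ?] := improve_near_zero (q0 p.1) (q0 p.1.+1) good; exists f'.
have [next nextP] := choice step.
pose f := fix f n : Z -> X := if n is m.+1 then next (m, f m) else f0.
have good n : good_near_zero A (q n) (f n).
  elim: n => [|n IH]; last by have [] := nextP (n, f n) IH.
  by split=> //; exists c => // z _; exact: f0Xi.
have f_close n z : A z -> mdist (f n.+1 z) (f n z) <= q n.
  by have [_ + _] := nextP (n, f n) (good n); exact.
have f_const n z : q n <= u z -> f n.+1 z = f n z.
  by have [_ _ +] := nextP (n, f n) (good n); exact.
(* The bound is the geometric sum of [q j] for [n <= j < n + k]. *)
have f_close_add n k z : A z ->
    mdist (f (n + k)%N z) (f n z) <= 2 * q n - 2 * q (n + k)%N.
  move=> Az; elim: k => [|k IH]; first by rewrite addn0 mdistxx subrr.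
  have := metric_triangle (f (n + k.+1)%N z) (f (n + k)%N z) (f n z).
  by rewrite addnS; have := f_close (n + k)%N _ Az; rewrite qS; lra.
have f_const_add n k z : q n <= u z -> f (n + k)%N z = f n z.
  move=> nz; elim: k => [|k IH]; first by rewrite addn0.
  rewrite addnS f_const//; apply: le_trans nz.
  elim: (k) => [|j]; first by rewrite addn0.
  by apply: le_trans; rewrite addnS qS; have := q0 (n + j)%N; lra.
have limit z : exists y : X, (u z = 0 -> y = Xi z) /\
    (forall n, q n <= u z -> f n z = y).
  have [uz|uz] := eqVneq (u z) 0.
    by exists (Xi z); split=> // n; rewrite uz leNgt q0.
  have uz0 : 0 < u z by rewrite lt_neqAle eq_sym uz u_ge0.
  have [N Nz] := q_small _ uz0; exists (f N z); split.
    by move=> uz'; rewrite uz' eqxx in uz.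
  move=> n nz; rewrite -(f_const_add n N)// addnC.
  exact: f_const_add.
have [r rP] := choice limit.
exists r; last by move=> z; have [] := rP z.
apply: (@unif_continuous_on_limit _ f) => [n|e e0]; first by have [] := good n.
have [n ne] : exists n, q n <= e / 2 by apply: q_small; lra.
exists n => z Az; have [rXi rf] := rP z.
have [uz|uz] := eqVneq (u z) 0.
  rewrite rXi//; have [_ [c' c'0 /(_ z Az)]] := good n.
  rewrite uz => /(_ (ltW c'0)).
  have [_ ? _] := deltaP (q0 n); have := q0 n; lra.
have uz0 : 0 < u z by rewrite lt_neqAle eq_sym uz u_ge0.
have [N Nz] := q_small _ uz0.
rewrite -(rf N)// -(f_const_add N n)// addnC metric_sym.
by apply: le_trans (f_close_add _ _ _ Az) _; have := q0 (n + N)%N; lra.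
Qed.

End Retraction.

Lemma homotopy_modulus_exists (R : realType) (X : metricType R) :
  uniformly_locally_contractible X -> exists delta, homotopy_modulus X delta.
Proof.
move=> lc.
have /choice[d dP] (e : R) : exists d : R, 0 < e -> 0 < d /\
    forall (Y : uniformType) (f g : Y -> X),
      unif_continuous f -> unif_continuous g -> close_maps d f g ->
      uniformly_homotopic e f g.
  have [e0|] := pselect (0 < e); last by exists 0.
  by have [d d0 dP] := lc e e0; exists d.
exists (fun e => Num.min (d e) e) => e e0; have [d0 dh] := dP e e0; split.
- by rewrite lt_min d0.
- by rewrite ge_min lexx orbT.
- move=> Y f g uf ug fg; apply: dh => // s.
  by apply: le_trans (fg s) _; rewrite ge_min lexx.
Qed.

(** At small distance from the image [Xi] oscillates by at most [d], so balls of
    radius [c / 2] witness its [d]-continuity and the Hahn property applies on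
    the subspace [u <= c]. *)
Lemma Hahn_approximable_near_zero (R : realType) (X Z : metricType R)
    (u : Z -> R) (Xi : Z -> X) :
  Hahn_property X ->
  (forall e : R, 0 < e -> exists2 c : R, 0 < c & forall z z',
    u z <= c -> u z' <= c -> mdist z z' < c -> mdist (Xi z) (Xi z') <= e) ->
  approximable_near_zero u Xi.
Proof.
move=> hahn Xi_cont e /hahn[d d0 approx].
have [c c0 cXi] := Xi_cont d d0; exists c => //.
pose A := [set z | u z <= c]; pose xi : set_type A -> X := Xi \o set_val.
have [|f uf fxi] := approx _ xi.
  pose b (y : set_type A) : set (set_type A) :=
    [set z | mdist (set_val y) (set_val z) < c / 2].
  exists (range b).
    exists [set p | mdist (set_val p.1) (set_val p.2) < c / 2].
      by apply/entourage_set_typeP; exists (c / 2) => //; rewrite divr_gt0.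
    by move=> y; exists (b y) => //; exists y.
  move=> _ [a _ <-] y z; rewrite /b /= => ay az.
  apply: cXi; [exact: (set_valP y)|exact: (set_valP z)|].
  have := metric_triangle (set_val y) (set_val a) (set_val z).
  by rewrite (metric_sym (set_val y) (set_val a)); lra.
pose F z := if pselect (A z) is left Az then f (SigSub (mem_set Az)) else Xi z.
have FE z (Az : A z) : F z = f (SigSub (mem_set Az)).
  by rewrite /F; case: pselect => // Az'; congr f; apply: val_inj.
exists F; last by move=> z Az; rewrite (FE z Az); exact: fxi.
move=> e' e'0; have /unif_continuous_mdistP/(_ e' e'0) := uf.
move=> /entourage_set_typeP[d' d'0 fd']; exists d' => // z z' Az Az' zz'.
by rewrite (FE z Az) (FE z' Az'); exact: fd'.
Qed.

(** * Retracting onto a closed image *)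

Section DistanceToImage.
Variables (R : realType) (X Z : metricType R) (i : X -> Z) (x0 : X).

Definition dist_image (z : Z) : R := inf (range (fun x => mdist z (i x))).

Let image_nonempty z : range (fun x => mdist z (i x)) !=set0.
Proof. by exists (mdist z (i x0)), x0. Qed.

Let image_lbound z : has_lbound (range (fun x => mdist z (i x))).
Proof. by exists 0 => _ [x _ <-]; exact: mdist_ge0. Qed.

Lemma dist_image_ge0 z : 0 <= dist_image z.
Proof. by apply: lb_le_inf => // _ [x _ <-]; exact: mdist_ge0. Qed.

Lemma dist_image_le z x : dist_image z <= mdist z (i x).
Proof. by apply: ge_inf => //; exists x. Qed.

Lemma dist_image_lipschitz z z' :
  `|dist_image z - dist_image z'| <= mdist z z'.
Proof.
have le w w' : dist_image w - mdist w w' <= dist_image w'.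
  apply: lb_le_inf => // _ [x _ <-].
  by have := dist_image_le w x; have := metric_triangle w w' (i x); lra.
by have := le z z'; have := le z' z; rewrite (metric_sym z') ler_norml; lra.
Qed.

Lemma dist_image_lt z e : dist_image z < e -> exists x, mdist z (i x) < e.
Proof.
move=> ze; have e0 : 0 < e - dist_image z by rewrite subr_gt0.
have [|_ [x _ <-] xe] := inf_adherent e0 (E := range (fun x => mdist z (i x))).
  by split.
by exists x; apply: lt_le_trans xe _; rewrite /dist_image addrC subrK.
Qed.

Lemma dist_image_eq0 z :
  closed (range i) -> dist_image z = 0 -> exists x, i x = z.
Proof.
move=> /closure_id cl z0; suff : range i z by case=> x _; exists x.
rewrite cl => V /nbhs_ballP[e /= e0 eV].
have [x xe] : exists x, mdist z (i x) < e by apply: dist_image_lt; rewrite z0.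
exists (i x); split; first by exists x.
by apply: eV; rewrite ballEmdist.
Qed.

(** The factor 2 allows an approximately nearest point to be chosen when the
    distance is positive; at distance 0 closedness of the image is used. *)
Lemma nearest_point_exists : injective i -> closed (range i) ->
  exists Xi : Z -> X, (forall x, Xi (i x) = x) /\
    forall z, mdist z (i (Xi z)) <= 2 * dist_image z.
Proof.
move=> inj cl.
have /choice[Xi XiP] z : exists x, mdist z (i x) <= 2 * dist_image z.
  have [z0|z0] := eqVneq (dist_image z) 0.
    have [x <-] := dist_image_eq0 cl z0; exists x.
    by rewrite mdistxx mulr_ge0 ?dist_image_ge0.
  have zpos : 0 < dist_image z by rewrite lt_neqAle eq_sym z0 dist_image_ge0.
  have [x zx] : exists x, mdist z (i x) < 2 * dist_image z.
    by apply: dist_image_lt; lra.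
  by exists x; exact: ltW.
exists Xi; split=> // x; apply/inj/esym/mdist_positivity.
apply/eqP; rewrite eq_le mdist_ge0 andbT; apply: le_trans (XiP _) _.
by have := dist_image_le (i x) x; rewrite mdistxx; lra.
Qed.

End DistanceToImage.

Lemma uniform_ANR_of_contractible_Hahn (R : realType) (X : metricType R) :
  uniformly_locally_contractible X -> Hahn_property X -> uniform_ANR X.
Proof.
move=> /homotopy_modulus_exists[delta deltaP] hahn Z i [inj ui [g ug gK]] cl.
(* If [X] is empty, the empty set is a uniform neighborhood of its image. *)
have [[x0 _]|nX] := pselect (exists x : X, True); last first.
  exists set0; first by exists 1 => // a z [x]; case: nX; exists x.
  exists set_val; split=> [|w|w].
  - by apply: (@unif_continuous_on_set_val _ _ _ _ id) => e e0; exists e.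
  - by case: (set_valP w).
  - by [].
have [Xi [XiK Xi_near]] := nearest_point_exists x0 inj cl.
have i_inv e : 0 < e -> exists2 d, 0 < d &
    forall x y, mdist (i x) (i y) < d -> mdist x y < e.
  move=> e0; have /unif_continuous_mdistP/(_ e e0) := ug.
  move=> /entourage_set_typeP[d d0 gd]; exists d => // x y xy.
  have ir w : i w \in range i by apply/mem_set; exists w.
  have gE w : g (SigSub (ir w)) = w by apply: inj; rewrite gK.
  by rewrite -(gE x) -(gE y); exact: gd.
have [|c c0 [r ur rXi]] := retraction_near_zero (dist_image_lipschitz i x0)
    deltaP _ (dist_image_ge0 i x0) (Xi := Xi).
  apply: Hahn_approximable_near_zero => // e /i_inv[d d0 id].
  (* [2 u z + mdist z z' + 2 u z' < 5 d / 6]. *)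
  exists (d / 6); first by rewrite divr_gt0.
  move=> z z' uz uz' zz'; apply/ltW/id.
  have := Xi_near z; have := Xi_near z'; rewrite (metric_sym z).
  have := metric_triangle (i (Xi z)) z (i (Xi z')).
  by have := metric_triangle z z' (i (Xi z')); lra.
pose A := [set z | dist_image i z <= c].
exists A.
  exists c => // _ z [x _ <-] xz; rewrite /A /=.
  by apply: le_trans (dist_image_le i z x) _; rewrite metric_sym ltW.
exists (i \o r \o set_val); split=> [|w|w [x _ xw]].
- apply/unif_continuous_mdistP => e e0.
  have /entourage_mdistP[d d0 id] := (unif_continuous_mdistP i).1 ui e e0.
  have [d' d'0 rd'] := ur d d0.
  apply/entourage_set_typeP; exists d' => // a b ab.
  by apply: id; apply: rd' => //; exact: set_valP.
- by exists (r (set_val w)).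
- rewrite /comp -xw rXi ?XiK//; apply/eqP; rewrite eq_le dist_image_ge0// andbT.
  by have := dist_image_le i (i x) x; rewrite mdistxx.
Qed.

(** * Regularization of families of functions *)

(** The regularization is [h w y = sup (k w z - r / r0)], over all [z] at
    distance less than [r] from [y] in a pseudometric whose [r0]-balls refine
    [E].  It is [1 / r0]-Lipschitz by construction.  Taking [z = y] gives
    [k <= h]; and [h <= k + d] since [r <= r0] puts [(y, z)] in [E], while for
    [r > r0] the penalty exceeds the total oscillation 1 of [k w].  The modulus
    is the same for all [w], which makes [y |-> h ^~ y] uniformly continuous for
    the supremum distance. *)
Lemma equicontinuous_approximation (R : realType) (Y : uniformType) (W : Type)
    (E : set (Y * Y)) (k : W -> Y -> R) (d : R) :
  entourage E -> (forall w y, 0 <= k w y <= 1) ->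
  (forall w y z, E (y, z) -> `|k w y - k w z| <= d) ->
  exists h : W -> Y -> R, [/\ forall w y, 0 <= h w y <= 1,
    forall w y, `|h w y - k w y| <= d &
    forall e : R, 0 < e ->
      entourage [set p : Y * Y | forall w, `|h w p.1 - h w p.2| <= e]].
Proof.
move=> entE k01 kd.
(* [Y] with the coarser, pseudometrizable uniformity generated by [E]. *)
pose G : pseudoMetricType R := gauge.type entE.
have entG (V : set (Y * Y)) : entourage (V : set (G * G)) -> entourage V.
  exact: gauge.gauge_ent.
have [r0 r00 r0E] : exists2 r0 : R, 0 < r0 &
    forall y z : G, ball y r0 z -> E (y, z).
  have : entourage (E : set (G * G)) by exists 0%N => // -[y z] [].
  rewrite -entourage_from_ballE => -[r0 r00 r0E].
  by exists r0 => // y z yz; exact: (r0E (y, z)).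
pose S w (y : G) : set R :=
  [set s | exists z : G, exists r : R,
    [/\ 0 < r, ball y r z & s = k w z - r / r0]].
have S_le1 w y : ubound (S w y) 1.
  move=> _ [z [r [r_gt0 _ ->]]]; have /andP[_] := k01 w z.
  have : 0 < r / r0 by rewrite divr_gt0.
  by lra.
have S_led w y : ubound (S w y) (k w y + d).
  move=> _ [z [r [r_gt0 yz ->]]].
  have r_pos : 0 < r / r0 by rewrite divr_gt0.
  have [rr0|rr0] := leP r r0.
    have /kd - /(_ w) : E (y, z) by apply/r0E/(le_ball rr0).
    by rewrite ler_norml => /andP[+ _]; lra.
  have : 1 < r / r0 by rewrite ltr_pdivlMr// mul1r.
  have /andP[_] := k01 w z; have /andP[+ _] := k01 w y.
  have : 0 <= d by apply: le_trans (kd w y y (entourage_refl _ entE)).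
  by lra.
have S_near w y r : 0 < r -> S w y (k w y - r / r0).
  by move=> r_gt0; exists y, r; split=> //; exact: ballxx.
have S_sup w y : has_sup (S w y).
  by split; [exists (k w y - 1 / r0); exact: S_near|exists 1; exact: S_le1].
pose h w (y : Y) := sup (S w y).
have k_le_h w y : k w y <= h w y.
  apply/ler_addgt0Pr => e e0; rewrite -lerBlDr.
  have := S_near w y (e * r0) (mulr_gt0 e0 r00).
  by rewrite mulfK ?gt_eqF//; apply: sup_upper_bound.
have h_le w y b : ubound (S w y) b -> h w y <= b.
  by apply: ge_sup; have [] := S_sup w y.
have h_lip w (y z : G) s : 0 < s -> ball y s z -> h w z <= h w y + s / r0.
  move=> s0 yz; apply: h_le => _ [x [r [r_gt0 zx ->]]].
  have /(sup_upper_bound (S_sup w y)) : S w y (k w x - (s + r) / r0).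
    by exists x, (s + r); split; [exact: addr_gt0|exact: ball_triangle zx|].
  by rewrite -/(h w y) mulrDl; lra.
exists h; split=> [w y|w y|e e0].
- have := k_le_h w y; have := h_le w y _ (S_le1 w y).
  by have /andP[+ _] := k01 w y; lra.
- have := k_le_h w y; have := h_le w y _ (S_led w y).
  by rewrite ler_norml; lra.
- apply: entG; have er0 : 0 < e * r0 by exact: mulr_gt0.
  apply: filterS (entourage_ball G (PosNum er0)) => -[y z] /= yz w.
  have := h_lip w _ _ _ er0 yz; have := h_lip w _ _ _ er0 (ball_sym yz).
  by rewrite mulfK ?gt_eqF// ler_norml; lra.
Qed.

(** * The collar of a metric space *)

Definition kuratowski (R : realType) (X : metricType R) (x w : X) : R :=
  Num.min (mdist x w) 1.

(** [coord None] is the height and [coord \o Some] a point of the cube of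
    functions [X -> [0, 1]]; at height 0 only the Kuratowski image of [X] is
    kept.  Making the height one more coordinate turns the product metric into
    a plain supremum metric. *)
Record collar (R : realType) (X : metricType R) := Collar {
  coord :> option X -> R;
  coord_itv : forall o, 0 <= coord o <= 1;
  collar_base : coord None = 0 ->
    exists x, forall w, coord (Some w) = kuratowski x w }.

HB.instance Definition _ (R : realType) (X : metricType R) :=
  gen_eqMixin (collar X).
HB.instance Definition _ (R : realType) (X : metricType R) :=
  gen_choiceMixin (collar X).

Section Collar.
Variables (R : realType) (X : metricType R).
Implicit Types (p q : collar X) (x w : X) (o : option X).

Lemma collar_eq p q : (forall o, p o = q o) -> p = q.
Proof.
case: p q => [p p01 pb] [q q01 qb] /= /funext pq.
by subst q; congr Collar; exact: Prop_irrelevance.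
Qed.

Definition collar_dist p q : R := sup (range (fun o => `|p o - q o|)).

Lemma collar_distP p q (b : R) :
  collar_dist p q <= b <-> forall o, `|p o - q o| <= b.
Proof.
have dist_le1 o : `|p o - q o| <= 1.
  have := coord_itv p o; have := coord_itv q o.
  by rewrite ler_norml; lra.
have dist_sup : has_sup (range (fun o => `|p o - q o|)).
  split; first by exists `|p None - q None|, None.
  by exists 1 => _ [a _ <-].
split=> [pq o|pq].
- by apply: le_trans pq; apply: sup_upper_bound => //; exists o.
- by apply: ge_sup; [case: dist_sup|move=> _ [a _ <-]].
Qed.

Lemma collar_distxx p : collar_dist p p = 0.
Proof.
apply/eqP; rewrite eq_le; apply/andP; split.
- by apply/collar_distP => o; rewrite subrr normr0.
- by apply: le_trans ((collar_distP p p _).1 (lexx _) None).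
Qed.

Lemma collar_dist_eq0 p q : collar_dist p q = 0 -> p = q.
Proof.
move=> pq; apply: collar_eq => o; apply/eqP; rewrite -subr_eq0 -normr_le0.
by move: o; apply/collar_distP; rewrite pq.
Qed.

Lemma collar_dist_sym p q : collar_dist p q = collar_dist q p.
Proof.
by apply/eqP; rewrite eq_le; apply/andP; split; apply/collar_distP => o;
  rewrite distrC; move: o; apply/collar_distP.
Qed.

Lemma collar_dist_triangle q p r :
  collar_dist p r <= collar_dist p q + collar_dist q r.
Proof.
apply/collar_distP => o; apply: le_trans (ler_distD (q o) _ _) _.
by apply: lerD; move: o; apply/collar_distP.
Qed.

HB.instance Definition _ := @isMetric.Build R (collar X) collar_dist
  collar_distxx collar_dist_eq0 collar_dist_sym collar_dist_triangle.

Lemma mdist_collarP p q (b : R) :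
  mdist p q <= b <-> forall o, `|p o - q o| <= b.
Proof. exact: collar_distP. Qed.

Lemma kuratowski_itv x w : 0 <= kuratowski x w <= 1.
Proof. by rewrite /kuratowski le_min mdist_ge0 ler01 ge_min lexx orbT. Qed.

Lemma kuratowski_lipschitz x y w :
  `|kuratowski x w - kuratowski y w| <= mdist x y.
Proof.
have := metric_triangle x y w; have := metric_triangle y x w.
rewrite (metric_sym y x) /kuratowski ler_norml.
have := mdist_ge0 x y.
by case: (lerP (mdist x w) 1) => ?; case: (lerP (mdist y w) 1) => ?; lra.
Qed.

Definition base_coord x o : R := if o is Some w then kuratowski x w else 0.

Lemma base_coord_itv x o : 0 <= base_coord x o <= 1.
Proof. by case: o => [w|] /=; [exact: kuratowski_itv|rewrite lexx ler01]. Qed.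

Lemma base_coord_base x : base_coord x None = 0 ->
  exists x', forall w, base_coord x (Some w) = kuratowski x' w.
Proof. by exists x. Qed.

Definition base x : collar X := Collar (base_coord_itv x) (@base_coord_base x).

Lemma mdist_base_le x y : mdist (base x) (base y) <= mdist x y.
Proof.
apply/mdist_collarP => -[w|] /=; first exact: kuratowski_lipschitz.
by rewrite subrr normr0 mdist_ge0.
Qed.

(** The coordinate of index [y] recovers [mdist x y], below the truncation. *)
Lemma mdist_base_lt x y (e : R) :
  e <= 1 -> mdist (base x) (base y) < e -> mdist x y < e.
Proof.
move=> e1; apply: contraTT; rewrite -!leNgt => exy.
apply: le_trans ((mdist_collarP (base x) (base y) _).1 (lexx _) (Some y)) => /=.
rewrite {2}/kuratowski mdistxx (min_l ler01) subr0 ger0_norm.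
  by rewrite /kuratowski le_min exy.
by have /andP[] := kuratowski_itv x y.
Qed.

Lemma range_base : range base = [set p | p None = 0].
Proof.
apply/seteqP; split=> [_ [x _ <-] //|p /= p0].
have [x px] := collar_base p0; exists x => //.
by apply: collar_eq => -[w|] /=; rewrite ?px.
Qed.

Lemma closed_range_base : closed (range base).
Proof.
rewrite range_base => p clp /=; apply/eqP; rewrite -normr_le0.
apply/ler_addgt0Pr => e e0; rewrite add0r.
have [q [/= q0]] := clp _ (nbhsx_ballx p e e0).
rewrite ballEmdist /= => /ltW/mdist_collarP/(_ None).
by rewrite q0 subr0.
Qed.

Lemma base_inj : injective base.
Proof.
move=> x y xy; apply: mdist_positivity; apply/eqP.
rewrite eq_le mdist_ge0 andbT; apply/ler_addgt0Pr => e e0; rewrite add0r.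
apply: (@le_trans _ _ (Num.min e 1)); last by rewrite ge_min lexx.
apply/ltW/mdist_base_lt; first by rewrite ge_min lexx orbT.
by rewrite xy mdistxx lt_min e0 ltr01.
Qed.

Lemma base_uniform_embedding : uniform_embedding base.
Proof.
split; first exact: base_inj.
  apply/unif_continuous_mdistP => e e0; apply/entourage_mdistP; exists e => //.
  by move=> x y; apply: le_lt_trans; exact: mdist_base_le.
have /choice[g gK] (s : set_type (range base)) : exists x, base x = set_val s.
  by have [x _ xs] := set_valP s; exists x.
exists g => //; apply/unif_continuous_mdistP => e e0.
apply/entourage_set_typeP; exists (Num.min e 1).
  by rewrite lt_min e0 ltr01.
move=> s t st /=; apply: (@lt_le_trans _ _ (Num.min e 1)).
  by apply: mdist_base_lt; [rewrite ge_min lexx orbT|rewrite !gK].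
by rewrite ge_min lexx.
Qed.

(** The only use of the ANR property: composing with the retraction of a
    neighbourhood of the base.  The last clause makes the result exact where the
    given map already takes values in the base, which fixes the ends of a
    homotopy. *)
Lemma push_into_base (e : R) : uniform_ANR X -> 0 < e ->
  exists2 d : R, 0 < d & forall (Y : uniformType) (P : Y -> collar X)
    (xi : Y -> X),
    unif_continuous P -> (forall y, mdist (base (xi y)) (P y) <= d) ->
    exists f : Y -> X, [/\ unif_continuous f, close_maps e f xi &
      forall y x, P y = base x -> f y = x].
Proof.
move=> anr e0.
have [U [c c0 cU] [r [ur r_im rK]]] :=
  anr _ _ base_uniform_embedding closed_range_base.
have [inj _ [g ug gK]] := base_uniform_embedding.
have range_r s : r s \in range base by apply/mem_set; exact: r_im.
pose rho s := g (SigSub (range_r s)).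
have rhoK s : base (rho s) = r s by rewrite gK.
have u_rho : unif_continuous rho.
  apply/unif_continuous_mdistP => e' /(unif_continuous_mdistP g).1 - /(_ ug).
  move=> /entourage_set_typeP[d d0 gd].
  apply: filterS ((unif_continuous_mdistP r).1 ur d d0) => p /=.
  exact: (gd (SigSub (range_r p.1)) (SigSub (range_r p.2))).
have /unif_continuous_mdistP/(_ e e0)/entourage_set_typeP[d d0 rho_d] := u_rho.
exists (Num.min c d / 2); first by rewrite divr_gt0// lt_min c0.
move=> Y P xi uP P_near.
have P_lt y : mdist (base (xi y)) (P y) < Num.min c d.
  apply: le_lt_trans (P_near y) _.
  by rewrite ltr_pdivrMr// ltr_pMr ?ltr1n// lt_min c0.
have PU y : P y \in U.
  apply/mem_set/(cU (base (xi y))); first by exists (xi y).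
  by have := P_lt y; rewrite lt_min => /andP[].
have rho_base s x : set_val s = base x -> rho s = x.
  by move=> sx; apply: inj; rewrite rhoK rK sx//; exists x.
exists (fun y => rho (SigSub (PU y))); split.
- apply/unif_continuous_mdistP => e' e'0.
  have /unif_continuous_mdistP/(_ e' e'0) := u_rho.
  move=> /entourage_set_typeP[d' d'0 rd'].
  apply: filterS ((unif_continuous_mdistP P).1 uP d' d'0) => p /=.
  exact: (rd' (SigSub (PU p.1)) (SigSub (PU p.2))).
- move=> y; have bU : base (xi y) \in U.
    by apply/mem_set/(cU (base (xi y))); [exists (xi y)|rewrite mdistxx].
  have xiE : rho (SigSub bU) = xi y by exact: rho_base.
  rewrite -xiE metric_sym; apply/ltW.
  apply: (rho_d (SigSub bU) (SigSub (PU y))) => /=.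
  by have := P_lt y; rewrite lt_min => /andP[].
- by move=> y x Px; exact: rho_base.
Qed.

(** * Uniform ANRs are locally contractible and have the Hahn property *)

Lemma convex_itv (t a b x y : R) : 0 <= t <= 1 -> a <= x <= b -> a <= y <= b ->
  a <= (1 - t) * x + t * y <= b.
Proof.
move=> /andP[t0 t1] /andP[ax xb] /andP[ay yb].
have := mulr_ge0 (_ : 0 <= 1 - t) (_ : 0 <= x - a).
have := mulr_ge0 (_ : 0 <= 1 - t) (_ : 0 <= b - x).
have := mulr_ge0 t0 (_ : 0 <= y - a); have := mulr_ge0 t0 (_ : 0 <= b - y).
rewrite !subr_ge0 => /(_ yb) ? /(_ ay) ? /(_ t1 xb) ? /(_ t1 ax) ?.
by apply/andP; split; lra.
Qed.

Lemma uniform_ANR_Hahn : uniform_ANR X -> Hahn_property X.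
Proof.
move=> anr e e0; have [d d0 push] := push_into_base anr e0.
pose d1 := Num.min d 1.
have d10 : 0 < d1 by rewrite lt_min d0 ltr01.
have d1_le1 : d1 <= 1 by rewrite ge_min lexx orbT.
exists d1 => // Y xi [C [E entE EC] Cd].
have [|w y z Eyz|h [h01 h_near h_cont]] :=
    equicontinuous_approximation (k := fun w y => kuratowski (xi y) w) (d := d1)
      entE.
- by move=> w y; exact: kuratowski_itv.
- have [U CU EU] := EC y; apply: le_trans (kuratowski_lipschitz _ _ _) _.
  by apply: (Cd U CU); apply: EU => //=; exact: entourage_refl.
(* At the constant positive height [d1] the base condition is void. *)
pose coords y o := if o is Some w then h w y else d1.
have coords_itv y o : 0 <= coords y o <= 1.
  by case: o => [w|] /=; [exact: h01|rewrite d1_le1 ltW].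
have coords_base y : coords y None = 0 ->
    exists x, forall w, coords y (Some w) = kuratowski x w.
  by move=> /= d1_eq0; rewrite d1_eq0 ltxx in d10.
pose P y : collar X := Collar (coords_itv y) (@coords_base y).
have [||f [uf f_xi _]] := push Y P xi; last by exists f.
- apply/unif_continuous_mdistP => e' e'0.
  have e'2 : 0 < e' / 2 by rewrite divr_gt0.
  apply: filterS (h_cont _ e'2) => -[y z] /= hyz.
  apply: (@le_lt_trans _ _ (e' / 2)); last by lra.
  by apply/mdist_collarP => -[w|] /=; [exact: hyz|rewrite subrr normr0 ltW].
- move=> y; apply: (@le_trans _ _ d1); last by rewrite ge_min lexx.
  apply/mdist_collarP => -[w|] /=; first by rewrite distrC; exact: h_near.
  by rewrite sub0r normrN gtr0_norm.
Qed.

Lemma uniform_ANR_contractible :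
  uniform_ANR X -> uniformly_locally_contractible X.
Proof.
move=> anr e e0; have [d d0 push] := push_into_base anr e0.
pose d1 := Num.min d 1.
have d10 : 0 < d1 by rewrite lt_min d0 ltr01.
have d1_le1 : d1 <= 1 by rewrite ge_min lexx orbT.
exists d1 => // Y f g uf ug fg.
pose I := set_type (`[0, 1] : set R).
have I01 (t : I) : 0 <= set_val t <= 1.
  by have := set_valP t; rewrite /= in_itv.
(* The height [d1 t (1 - t)] vanishes exactly at the ends of the segment from
   [f y] to [g y], so that the path meets height 0 only in the base. *)
pose coords (yt : Y * I) o : R := let t := set_val yt.2 in
  if o is Some w
  then (1 - t) * kuratowski (f yt.1) w + t * kuratowski (g yt.1) w
  else d1 * (t * (1 - t)).
have coords_itv yt o : 0 <= coords yt o <= 1.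
  case: o => [w|] /=.
    by apply: convex_itv; [exact: I01|exact: kuratowski_itv..].
  have mul01 (a b : R) : 0 <= a <= 1 -> 0 <= b <= 1 -> 0 <= a * b <= 1.
    by move=> /andP[a0 a1] /andP[b0 b1]; rewrite mulr_ge0//= mulr_ile1.
  have t01 := I01 yt.2; apply: (mul01); first by rewrite ltW.
  by apply: (mul01) => //; lra.
have coords0 y t : set_val t = 0 -> forall o, coords (y, t) o = base (f y) o.
  by move=> t0 [w|] /=; rewrite t0 ?subr0 ?mul1r mul0r ?addr0// mulr0.
have coords1 y t : set_val t = 1 -> forall o, coords (y, t) o = base (g y) o.
  by move=> t1 [w|] /=; rewrite t1 subrr ?mul0r ?add0r ?mul1r// mulr0.
have coords_base yt : coords yt None = 0 ->
    exists x, forall w, coords yt (Some w) = kuratowski x w.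
  case: yt => y t /eqP; rewrite /= !mulf_eq0 gt_eqF//= subr_eq0.
  move=> /orP[]/eqP t01.
  - by exists (f y) => w; exact: (coords0 y t t01 (Some w)).
  - by exists (g y) => w; exact: (coords1 y t (esym t01) (Some w)).
pose P yt : collar X := Collar (coords_itv yt) (@coords_base yt).
have [||H [uH H_near H_base]] := push (Y * I)%type P (f \o fst).
- apply/unif_continuous_mdistP => e' e'0.
  have e'4 : 0 < e' / 4 by rewrite divr_gt0.
  apply/entourage_prodP.
  exists ([set p | mdist (f p.1) (f p.2) < e' / 4] `&`
          [set p | mdist (g p.1) (g p.2) < e' / 4]).
  exists [set p | `|set_val p.1 - set_val p.2| < e' / 4]; split.
  + apply: filterI; first exact: (unif_continuous_mdistP f).1.
    exact: (unif_continuous_mdistP g).1.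
  + exists [set p : R * R | `|p.1 - p.2| < e' / 4] => //.
    by rewrite -(@entourage_from_ballE R R); exists (e' / 4).
  move=> y t z s [/= fyz gyz] ts.
  apply: (@le_lt_trans _ _ (e' / 4 + e' / 4 + e' / 4)); last by lra.
  apply/mdist_collarP => -[w|] /=.
    rewrite (_ : _ - _ =
      (1 - set_val t) * (kuratowski (f y) w - kuratowski (f z) w)
        + set_val t * (kuratowski (g y) w - kuratowski (g z) w)
        + (set_val t - set_val s) * (kuratowski (g z) w - kuratowski (f z) w));
      last by lra.
    apply: le_trans (ler_normD _ _) _; apply: lerD; first last.
      rewrite normrM -[X in _ <= X]mulr1; apply: ler_pM => //; first exact: ltW.
      have := kuratowski_itv (f z) w; have := kuratowski_itv (g z) w.
      by rewrite ler_norml; lra.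
    rewrite ler_norml (_ : e' / 4 + e' / 4 = e' / 2); last by lra.
    apply: convex_itv; first exact: I01.
      have := le_trans (kuratowski_lipschitz _ _ w) (ltW fyz).
      by rewrite ler_norml; lra.
    have := le_trans (kuratowski_lipschitz _ _ w) (ltW gyz).
    by rewrite ler_norml; lra.
  rewrite (_ : _ - _ =
    d1 * ((set_val t - set_val s) * (1 - set_val t - set_val s))); last by lra.
  rewrite !normrM gtr0_norm//.
  apply: (@le_trans _ _ (1 * (e' / 4 * 1))); last by lra.
  apply: ler_pM => //; rewrite ?mulr_ge0//; first exact: ltW.
  apply: ler_pM => //; first exact: ltW.
  by have := I01 t; have := I01 s; rewrite ler_norml; lra.
- move=> [y t]; apply: (@le_trans _ _ d1); last by rewrite ge_min lexx.
  have t01 := I01 t; apply/mdist_collarP => -[w|] /=.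
    rewrite (_ : _ - _ =
      set_val t * (kuratowski (f y) w - kuratowski (g y) w)); last by lra.
    rewrite normrM -[X in _ <= X]mul1r; apply: ler_pM => //.
      by rewrite ler_norml; lra.
    exact: le_trans (kuratowski_lipschitz _ _ w) (fg y).
  rewrite sub0r normrN normrM gtr0_norm// -[X in _ <= X]mulr1.
  by rewrite ler_pM2l// ler_norml; nra.
- exists H; split=> // y t t01; apply: H_base; apply: collar_eq => o.
  + exact: coords0.
  + exact: coords1.
Qed.

End Collar.

Theorem theorem13p17 (R : realType) (X : metricType R) :
  uniform_ANR X <-> uniformly_locally_contractible X /\ Hahn_property X.
Proof.
split=> [anr|[contractible hahn]].
  by split; [exact: uniform_ANR_contractible|exact: uniform_ANR_Hahn].
exact: uniform_ANR_of_contractible_Hahn.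
Qed.
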